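(* Let $\mathcal{L}=(\eta_1,\eta_2,\ldots)$ be a Leja sequence for the closed unit disk $\overline{\mathbb{D}}$. For $N\ge 1$ and $1\le k\le N$ let $l_k^{(N)}(z)=\prod_{j=1,\,j\ne k}^{N}\frac{z-\eta_j}{\eta_k-\eta_j}$. Then $$\sup_{N\ge k\ge 1}\ \Big(\sup_{z\in\overline{\mathbb{D}}}\big|l_k^{(N)}(z)\big|\Big)\ \le\ \pi\exp(3\pi).$$
   Context: $\overline{\mathbb{D}}=\{z\in\mathbb{C}:|z|\le 1\}$. A Leja sequence for a compact set $K\subset\mathbb{C}$ is a sequence $(\eta_1,\eta_2,\ldots)$ of points of $K$ with $\eta_1\in\partial K$ and, for all $k\ge2$, $\sup_{z\in K}\prod_{j=1}^{k-1}|z-\eta_j|=\prod_{j=1}^{k-1}|\eta_k-\eta_j|$. (Leja sequences are not unique; the statement is for an arbitrary one.) *)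

(* Defs.v *)
From HB Require Import structures.
From mathcomp Require Import all_boot all_order all_algebra.
From mathcomp Require Import all_classical all_reals all_analysis.
From mathcomp.real_closed Require Import complex.

Set Implicit Arguments.
Unset Strict Implicit.
Unset Printing Implicit Defensive.
Import Order.TTheory GRing.Theory Num.Theory.
Import numFieldNormedType.Exports.

Local Open Scope classical_set_scope.
Local Open Scope ring_scope.

(* The norm `|z| of z : R[i] is itself an element of R[i], namely the modulus
   viewed as a complex number; [cmod z] is the same modulus as a real number. *)
Definition cmod (R : realType) (z : R[i]) : R := ComplexField.Normc.normc z.

Definition closed_unit_disk (R : realType) : set R[i] := [set z | `|z| <= 1].
Arguments closed_unit_disk R : clear implicits.

(* The cast to numFieldType selects the topology of R[i] given by its norm. *)
Definition boundary (R : realType) (K : set (R[i] : numFieldType)) : set R[i] :=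
  closure K `\` interior K.

(* Sequences are indexed from 1: the value [eta 0] is never used.  Suprema are
   taken in the extended reals, where they are meaningful without any
   boundedness condition.  The notion is meant for compact K. *)
Definition leja_sequence (R : realType) (K : set R[i]) (eta : nat -> R[i]) :
    Prop :=
  [/\ forall k, (1 <= k)%N -> K (eta k),
      boundary K (eta 1%N) &
      forall k, (2 <= k)%N ->
        ereal_sup [set (\prod_(1 <= j < k) cmod (z - eta j))%:E | z in K] =
        (\prod_(1 <= j < k) cmod (eta k - eta j))%:E].

Definition lagrange_basis (R : realType) (eta : nat -> R[i]) (N k : nat)
    (z : R[i]) : R[i] :=
  \prod_(1 <= j < N.+1 | j != k) ((z - eta j) / (eta k - eta j)).

Definition sup_modulus (R : realType) (K : set R[i]) (f : R[i] -> R[i]) :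
    \bar R :=
  ereal_sup [set (cmod (f z))%:E | z in K].

(* Main.v *)
Require Import Defs.
From HB Require Import structures.
From mathcomp Require Import all_boot all_order all_algebra.
From mathcomp Require Import all_classical all_reals all_analysis.
From mathcomp.real_closed Require Import complex.
From mathcomp Require Import ring lra.
Import Order.TTheory GRing.Theory Num.Theory.
Import numFieldNormedType.Exports.
Local Open Scope classical_set_scope.
Local Open Scope ring_scope.

(** If v is the point following the first N points of a Leja sequence of the
    disk, then prod_(j <= N) (X - eta_j) = prod_(n in s) (X^(2^n) + v^(2^n)),
    where s lists the binary digits equal to 1 of N.  Multiplying by X - v
    performs the carry of N + 1: the product telescopes to
    (X^(2^t) - v^(2^t)) prod_(n in s') (X^(2^n) + v^(2^n)) with t < s', and all
    its factors reach their maximal modulus 2 simultaneously, exactly when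
    X^(2^t) = - v^(2^t).

    A node u kills a single factor, say n = m.  The factors n > m contribute at
    most 1 to the Lagrange polynomial of u.  For n < m put
    x_n = |u^(2^n) + v^(2^n)| and y_n = |u^(2^n) - v^(2^n)|, so that
    y_(n+1) = x_n y_n.  Each ratio |z^(2^n) + v^(2^n)| / x_n is at most 2 / x_n,
    which telescopes against t_n = 2^n |z - u| / y_n, and at most
    1 + 2^n |z - u| / x_n.  The first bound is used while t_n > 1 and the second
    one below, giving a product of at most 2 e^4 max(1, 2^m |z - u| / 2).  The
    factor m, which is at most min(1, 2 / (2^m |z - u|)) after removal of its
    root u, compensates the maximum, so the Lagrange polynomials are bounded by
    2 e^4 < pi e^(3 pi). *)

(** * Real inequalities for products of ratios along repeated squaring *)

Section RealProducts.
Context {R : realType}.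

(** [B] selects the binary digits of N, [d] stands for |z - u| and [w n] for |z^(2^n) + v^(2^n)|. *)
Variables (B : pred nat) (d : R) (w x y : nat -> R).
Hypotheses (d_ge0 : 0 <= d) (w02 : forall n, 0 <= w n <= 2)
  (x02 : forall n, 0 <= x n <= 2) (y02 : forall n, 0 <= y n <= 2)
  (yS : forall n, y n.+1 = x n * y n)
  (w_le : forall n, w n <= x n + 2 ^+ n * d).

(** Positivity of [y] descends, so assuming it at [p] alone justifies every division by [x n] with n
    < p. *)
Let xy_gt0 n : 0 < y n.+1 -> 0 < x n /\ 0 < y n.
Proof.
rewrite yS => xy0; have /andP[x0 _] := x02 n; have /andP[y0 _] := y02 n.
by split; rewrite lt0r ?x0 ?y0 andbT; apply: contraTneq xy0 => ->;
  rewrite ?mul0r ?mulr0 ltxx.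
Qed.

Let factor_ge0 n : 0 <= w n / x n.
Proof.
have /andP[w0 _] := w02 n; have /andP[x0 _] := x02 n; exact: divr_ge0.
Qed.

(* [2 ^+ p * d * (1 + 2 / y p)] is chosen to increase by at least
   [2 ^+ p * d / x p] from [p] to [p.+1]. *)
Lemma prod_ratio_le_exp p : 0 < y p ->
  \prod_(0 <= n < p | B n) (w n / x n) <= expR (2 ^+ p * d * (1 + 2 / y p)).
Proof.
elim: p => [|p IH] yp.
  rewrite big_geq // expr0 mul1r; apply: le_trans (expR_ge1Dx _).
  by rewrite lerDl mulr_ge0 // addr_ge0 // divr_ge0 // ltW.
have [x0 y0] := xy_gt0 _ yp; have {IH} := IH y0.
have /andP[_ x2] := x02 p; have /andP[_ y2] := y02 p.
have D0 : 0 <= 2 ^+ p * d by rewrite mulr_ge0 // exprn_ge0.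
set Q := \prod_(0 <= n < p | _) _ => IH.
have Q0 : 0 <= Q by apply: prodr_ge0.
have key : 2 ^+ p * d / x p + 2 ^+ p * d * (1 + 2 / y p)
     <= 2 ^+ p.+1 * d * (1 + 2 / y p.+1).
  (* The last summand is the surplus; its numerator is nonnegative because [x p] and [y p] are at
     most 2. *)
  have -> : 2 ^+ p.+1 * d * (1 + 2 / y p.+1) =
      2 ^+ p * d / x p + 2 ^+ p * d * (1 + 2 / y p) +
      2 ^+ p * d * (((2 - x p) * (2 - y p) + y p) / (x p * y p)).
    by rewrite yS exprS; field; rewrite !gt_eqF.
  by rewrite lerDl mulr_ge0 // divr_ge0 ?mulr_ge0 ?addr_ge0 ?mulr_ge0 //;
    rewrite ?subr_ge0 // ltW.
rewrite big_mkcond big_nat_recr //= -big_mkcond /= -/Q.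
apply: le_trans (_ : Q * expR (2 ^+ p * d / x p) <= _).
  apply: ler_wpM2l => //; case: ifP => _.
    apply: le_trans (expR_ge1Dx _); rewrite ler_pdivrMr // mulrDl mul1r.
    by rewrite divfK ?gt_eqF.
  by rewrite -[leLHS]expR0 ler_expR divr_ge0 // ltW.
apply: le_trans (ler_wpM2r (expR_ge0 _) IH) _.
by rewrite -expRD ler_expR addrC.
Qed.

(** The ratio t_p = 2^p d / y_p is nondecreasing since [x p <= 2], so it crosses 1 at most once.
    Before the crossing the exponential bound gives e^4, the crossing costs a factor 2, and
    afterwards each factor is absorbed by the growth of t_p. *)
Lemma prod_ratio_le p : 0 < y p ->
  \prod_(0 <= n < p | B n) (w n / x n)
    <= 2 * expR 4 * Num.max 1 (2 ^+ p * d / y p).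
Proof.
have e4 : 1 <= expR 4 :> R by rewrite -[leLHS]expR0 ler_expR.
have max1 t : expR 4 <= 2 * expR 4 * Num.max 1 t :> R.
  by have : 1 <= Num.max 1 t; [rewrite le_max lexx | nra].
have small q : 0 < y q -> 2 ^+ q * d / y q <= 1 ->
    \prod_(0 <= n < q | B n) (w n / x n) <= expR 4.
  move=> y0 t1; apply: le_trans (prod_ratio_le_exp _ y0) _; rewrite ler_expR.
  have /andP[_ y2] := y02 q.
  (* The exponent 4 comes from here: the ratio is at most 1 and [y q + 2] at most 4. *)
  have -> : 2 ^+ q * d * (1 + 2 / y q) = 2 ^+ q * d / y q * (y q + 2).
    by field; rewrite gt_eqF.
  have t0 : 0 <= 2 ^+ q * d / y q.
    by rewrite divr_ge0 ?mulr_ge0 ?exprn_ge0 // ltW.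
  nra.
elim: p => [|p IH] yp.
  by rewrite big_geq // (le_trans e4).
have [x0 y0] := xy_gt0 _ yp; have {IH} := IH y0.
have /andP[_ x2] := x02 p; have /andP[_ y2] := y02 p.
have D0 : 0 <= 2 ^+ p * d by rewrite mulr_ge0 // exprn_ge0.
set Q := \prod_(0 <= n < p | _) _ => IH.
have Q0 : 0 <= Q by apply: prodr_ge0.
have tS : 2 ^+ p.+1 * d / y p.+1 = 2 ^+ p * d / y p * (2 / x p).
  by rewrite yS exprS; field; rewrite !gt_eqF.
set t := 2 ^+ p * d / y p in IH tS *.
have t0 : 0 <= t by rewrite divr_ge0 // ltW.
have [t1|t1] := leP (2 ^+ p.+1 * d / y p.+1) 1.
  apply: le_trans (small _ yp t1) _; lra.
rewrite tS in t1 *.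
have x21 : 1 <= 2 / x p by rewrite ler_pdivlMr // mul1r.
rewrite big_mkcond big_nat_recr //= -big_mkcond /= -/Q.
have w2 : (if B p then w p / x p else 1) <= 2 / x p.
  by case: ifP => // _; rewrite ler_pM2r ?invr_gt0 //; case/andP: (w02 p).
have [t1'|t1'] := ltP 1 t.
  rewrite (max_idPr (ltW t1')) in IH.
  rewrite mulrA; apply: ler_pM => //; case: ifP => // _; exact: factor_ge0.
have /small : 2 ^+ p * d / y p <= 1 by [].
move=> /(_ y0); rewrite -/Q => Qe.
(* Crossing step: the next ratio T = t (2 / x_p) exceeds 1, so the factor is at most 1 + T <= 2
   T. *)
have w3 : (if B p then w p / x p else 1) <= 2 * (t * (2 / x p)).
  case: ifP => _; last lra.
  apply: (@le_trans _ _ (1 + 2 ^+ p * d / x p)).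
    by rewrite ler_pdivrMr // mulrDl mul1r divfK ?gt_eqF.
  have -> : 2 ^+ p * d / x p = t * (2 / x p) * (y p / 2).
    by rewrite /t; field; rewrite !gt_eqF.
  have : y p / 2 <= 1 by rewrite ler_pdivrMr // mul1r.
  have : 0 <= y p / 2 by rewrite divr_ge0 // ltW.
  nra.
apply: (@le_trans _ _ (expR 4 * (2 * (t * (2 / x p))))).
  by apply: ler_pM => //; case: ifP => // _; exact: factor_ge0.
by rewrite mulrA [expR 4 * 2]mulrC.
Qed.

End RealProducts.

(** * The real-valued modulus on [R[i]] *)

Section Modulus.
Context {R : realType}.
Implicit Types z u v : R[i].

Lemma normr_cmod z : `|z| = (cmod z)%:C%C.
Proof. by rewrite normc_def; case: z. Qed.

Lemma closed_unit_diskE z : closed_unit_disk R z <-> cmod z <= 1.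
Proof. by rewrite /closed_unit_disk /= normr_cmod lecR. Qed.

Lemma cmodM z u : cmod (z * u) = cmod z * cmod u.
Proof. exact: ComplexField.Normc.normcM. Qed.

Lemma cmodV z : cmod z^-1 = (cmod z)^-1.
Proof. exact: ComplexField.Normc.normcV. Qed.

Lemma cmodN z : cmod (- z) = cmod z.
Proof. by apply: (@complexI R); rewrite -!normr_cmod normrN. Qed.

Lemma cmod0 : cmod (0 : R[i]) = 0.
Proof. exact: ComplexField.Normc.normc0. Qed.

Lemma cmod1 : cmod (1 : R[i]) = 1.
Proof. exact: ComplexField.Normc.normc1. Qed.

Lemma cmodD z u : cmod (z + u) <= cmod z + cmod u.
Proof. by rewrite -lecR rmorphD -!normr_cmod ler_normD. Qed.

Lemma cmodB z u : cmod (z - u) <= cmod z + cmod u.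
Proof. by rewrite -(cmodN u); exact: cmodD. Qed.

Lemma cmod_ge0 z : 0 <= cmod z.
Proof. by rewrite -lecR -normr_cmod normr_ge0. Qed.

Lemma cmod_eq0 z : (cmod z == 0) = (z == 0).
Proof.
apply/eqP/eqP => [|->]; last exact: cmod0.
exact: ComplexField.Normc.eq0_normc.
Qed.

Lemma cmodX z n : cmod (z ^+ n) = cmod z ^+ n.
Proof.
by elim: n => [|n IH]; rewrite ?expr0 ?cmod1 // !exprS cmodM IH.
Qed.

Lemma cmod_nat n : cmod (n%:R : R[i]) = n%:R.
Proof.
apply: (@complexI R).
by rewrite -[LHS]normr_cmod normr_nat rmorph_nat.
Qed.

Lemma cmod_prod (I : Type) (r : seq I) (P : pred I) (F : I -> R[i]) :
  cmod (\prod_(i <- r | P i) F i) = \prod_(i <- r | P i) cmod (F i).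
Proof. by apply: (big_morph _ cmodM cmod1). Qed.

Lemma cmod_sum (I : Type) (r : seq I) (P : pred I) (F : I -> R[i]) :
  cmod (\sum_(i <- r | P i) F i) <= \sum_(i <- r | P i) cmod (F i).
Proof.
elim/big_ind2 : _ => //; first by rewrite cmod0.
by move=> ? ? ? ? h1 h2; apply: le_trans (cmodD _ _) _; exact: lerD.
Qed.

(** The sum is the cofactor of [z - u] in [z ^+ n - u ^+ n]. *)
Lemma cmod_sum_geom_le z u n : cmod z <= 1 -> cmod u <= 1 ->
  cmod (\sum_(i < n) z ^+ (n.-1 - i) * u ^+ i) <= n%:R.
Proof.
move=> z1 u1; apply: le_trans (cmod_sum _ _ _ _) _.
have -> : n%:R = \sum_(i < n) 1 :> R by rewrite sumr_const card_ord.
apply: ler_sum => i _; rewrite cmodM !cmodX.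
by apply: mulr_ile1; rewrite ?exprn_ge0 ?exprn_ile1 ?cmod_ge0.
Qed.

Lemma cmod_subX_le z u n : cmod z <= 1 -> cmod u <= 1 ->
  cmod (z ^+ n - u ^+ n) <= n%:R * cmod (z - u).
Proof.
move=> z1 u1; rewrite subrXX cmodM mulrC.
by apply: (ler_wpM2r (cmod_ge0 _)); exact: cmod_sum_geom_le.
Qed.

End Modulus.

(** * Dyadic factorization of the node polynomials *)

Section LejaStructure.
Context {R : realType}.

Lemma sqr_cmod (z : R[i]) : cmod z ^+ 2 = complex.Re z ^+ 2 + complex.Im z ^+ 2.
Proof. by case: z => a b; rewrite /cmod /= sqr_sqrtr // addr_ge0 // sqr_ge0. Qed.

Lemma cmod_parallelogram (z u : R[i]) :
  cmod (z - u) ^+ 2 + cmod (z + u) ^+ 2 = 2 * (cmod z ^+ 2 + cmod u ^+ 2).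
Proof. by rewrite !sqr_cmod; case: z u => [a b] [c d] /=; ring. Qed.

(** By the parallelogram law |z - u|^2 + |z + u|^2 <= 4, so the second term must vanish. *)
Lemma cmod_sub_ge2 (z u : R[i]) :
  cmod z <= 1 -> cmod u <= 1 -> 2 <= cmod (z - u) -> z = - u.
Proof.
move=> z1 u1 zu; apply/eqP; rewrite -addr_eq0 -cmod_eq0.
have := cmod_parallelogram z u; have := cmod_ge0 z; have := cmod_ge0 u.
have := cmod_ge0 (z + u); rewrite !expr2 => *; apply/eqP; nra.
Qed.

(** While the smallest digit equals [b], a difference of squares moves the carry to [b.+1]; [b] is
    arbitrary for the induction. The carry stops at [t], below all of [s']. *)
Lemma telescope_dyadic (A : comPzRingType) (x v : A) (s : seq nat) (b : nat) :
  sorted ltn s -> all (leq b) s ->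
  exists t s', path ltn t s' /\
    (x ^+ (2 ^ b) - v ^+ (2 ^ b)) * \prod_(n <- s) (x ^+ (2 ^ n) + v ^+ (2 ^ n))
    = (x ^+ (2 ^ t) - v ^+ (2 ^ t)) *
      \prod_(n <- s') (x ^+ (2 ^ n) + v ^+ (2 ^ n)).
Proof.
elim: s b => [|c s IH] b /=; first by move=> _ _; exists b, [::].
move=> cs /andP[]; rewrite leq_eqVlt => /predU1P[->|bc] bs; last first.
  by exists b, (c :: s); rewrite /= bc cs.
have [t [s' [ts' E]]] := IH c.+1 (path_sorted cs) (order_path_min ltn_trans cs).
exists t, s'; split => //; rewrite -E big_cons mulrA; congr (_ * _).
by rewrite -subr_sqr -!exprM -!expnSr.
Qed.

Lemma sqr_dyadic (A : comPzRingType) (x v : A) (t n : nat) : (t < n)%N ->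
  x ^+ (2 ^ t) = - v ^+ (2 ^ t) -> x ^+ (2 ^ n) = v ^+ (2 ^ n).
Proof.
move=> /subnKC <- E.
by rewrite expnD expnSr !exprM E sqrrN.
Qed.

Lemma interior_closed_unit_disk (x : R[i]) : cmod x < 1 ->
  interior (closed_unit_disk R : set (R[i] : numFieldType)) x.
Proof.
move=> x1; apply/nbhs_ballP; exists ((1 - cmod x)%:C%C) => /=.
  by rewrite ltcR subr_gt0.
move=> y; rewrite /ball /= => xy; apply/closed_unit_diskE.
rewrite normr_cmod ltcR in xy.
have := cmodD x (y - x); rewrite addrC subrK -[y - x]opprB cmodN; lra.
Qed.

Lemma leja_max (eta : nat -> R[i]) (k : nat) (z : R[i]) :
  leja_sequence (closed_unit_disk R) eta -> (2 <= k)%N -> cmod z <= 1 ->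
  \prod_(1 <= j < k) cmod (z - eta j) <= \prod_(1 <= j < k) cmod (eta k - eta j).
Proof.
case=> _ _ H k2 z1; rewrite -lee_fin -H //; apply: ereal_sup_ubound.
by exists z => //; apply/closed_unit_diskE.
Qed.

(** Both claims go through one induction: finding the next point requires that the current one be
    unimodular. The identity is between polynomials so that a linear factor can be cancelled
    later. *)
Lemma leja_factorization (eta : nat -> R[i]) (N : nat) :
  leja_sequence (closed_unit_disk R) eta ->
  cmod (eta N.+1) = 1 /\
  exists2 s, sorted ltn s &
    \prod_(1 <= j < N.+1) ('X - (eta j)%:P) =
    \prod_(n <- s) ('X ^+ (2 ^ n) + (eta N.+1)%:P ^+ (2 ^ n)).
Proof.
move=> L; have K1 k : (1 <= k)%N -> cmod (eta k) <= 1.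
  by case: L => K1 _ _ /K1 /closed_unit_diskE.
elim: N => [|N [v1 [s ss Ws]]].
  split; last by exists [::]; rewrite // big_geq // big_nil.
  case: L => _ [_ b1] _; apply/eqP; rewrite eq_le K1 // leNgt.
  by apply/negP => /interior_closed_unit_disk.
set v := eta N.+1 in v1 Ws; set v' := eta N.+2.
have [t [s' [ts' E]]] :=
  telescope_dyadic _ ('X : {poly R[i]}) v%:P s 0 ss (introT allP (fun _ _ => isT)).
have {Ws E} W : \prod_(1 <= j < N.+2) ('X - (eta j)%:P) =
    ('X ^+ (2 ^ t) - v%:P ^+ (2 ^ t)) *
    \prod_(n <- s') ('X ^+ (2 ^ n) + v%:P ^+ (2 ^ n)).
  by rewrite -E big_nat_recr //= Ws mulrC.
have Wval z : \prod_(1 <= j < N.+2) cmod (z - eta j) =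
    cmod (z ^+ (2 ^ t) - v ^+ (2 ^ t)) *
    \prod_(n <- s') cmod (z ^+ (2 ^ n) + v ^+ (2 ^ n)).
  have /(congr1 (fun p : {poly R[i]} => cmod p.[z])) /= := W.
  rewrite hornerM !horner_prod cmodM !cmod_prod.
  under eq_bigr do rewrite hornerXsubC.
  move=> ->; rewrite hornerD hornerN !horner_exp hornerX hornerC; congr (_ * _).
  by apply: eq_bigr => n _; rewrite hornerD !horner_exp hornerX hornerC.
have s't n : n \in s' -> (t < n)%N by move/(allP (order_path_min ltn_trans ts')).
have t0 : (0 < 2 ^ t)%N by rewrite expn_gt0.
have vX n : cmod (v ^+ n) = 1 by rewrite cmodX v1 expr1n.
(* A competitor at which all factors have modulus 2 simultaneously. *)
have [v'' Ev''] : exists z : R[i], z ^+ (2 ^ t) = - v ^+ (2 ^ t).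
  by exists ((2 ^ t).-root (- v ^+ (2 ^ t))); rewrite rootCK.
have v''1 : cmod v'' = 1.
  have : cmod (v'' ^+ (2 ^ t)) = 1 by rewrite Ev'' cmodN vX.
  by rewrite cmodX => /eqP; rewrite pexpr_eq1 ?cmod_ge0 // => /eqP.
have cmod_dbl n : cmod (v ^+ n + v ^+ n) = 2.
  by rewrite -mulr2n -[_ *+ 2]mulr_natl [LHS]cmodM vX mulr1 cmod_nat.
have := leja_max eta N.+2 v'' L isT; rewrite v''1 lexx => /(_ isT).
rewrite !Wval Ev'' -opprD cmodN cmod_dbl => M.
have Ev' : v' ^+ (2 ^ t) = - v ^+ (2 ^ t).
  apply: cmod_sub_ge2; rewrite ?vX ?cmodX ?exprn_ile1 ?cmod_ge0 ?K1 //.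
  (* At [v'] the factors over [s'] are at most 2, while the whole product is at least its value at
     [v'']; cancelling powers of 2 leaves the first factor at least 2. *)
  have P2 : 0 < \prod_(n <- s') (2 : R) by apply: prodr_gt0.
  rewrite -(ler_pM2r P2); apply: le_trans (_ : _ <= _) (le_trans M _).
    rewrite ler_pM2l // big_seq [leRHS]big_seq; apply: ler_prod => n /s't tn.
    by rewrite (sqr_dyadic _ _ _ _ _ tn Ev'') cmod_dbl lexx andbT.
  apply: (ler_wpM2l (cmod_ge0 _)); apply: ler_prod => n _.
  rewrite cmod_ge0 /=; apply: le_trans (cmodD _ _) _; rewrite vX.
  by rewrite (_ : 2 = 1 + 1) // lerD2r cmodX exprn_ile1 ?cmod_ge0 ?K1.
split.
  have : cmod (v' ^+ (2 ^ t)) = 1 by rewrite Ev' cmodN vX.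
  by rewrite cmodX => /eqP; rewrite pexpr_eq1 ?cmod_ge0 // => /eqP.
exists (t :: s') => //; rewrite W big_cons -/v' -!rmorphXn /= Ev' rmorphN.
congr (_ * _); apply: eq_big_seq => n /s't tn.
by rewrite -!rmorphXn /= (sqr_dyadic _ _ _ _ _ tn Ev').
Qed.

End LejaStructure.

(** * Uniform bound for the Lagrange polynomials *)

Section LagrangeBound.
Context {R : realType}.
Implicit Types z u v : R[i].

Lemma prod_ratio_dyadic_le (s : seq nat) (m : nat) z u v :
  uniq s -> cmod z <= 1 -> cmod u = 1 -> cmod v = 1 ->
  u ^+ (2 ^ m) = - v ^+ (2 ^ m) ->
  \prod_(n <- s | n != m) (cmod (z ^+ (2 ^ n) + v ^+ (2 ^ n)) /
                           cmod (u ^+ (2 ^ n) + v ^+ (2 ^ n)))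
    <= 2 * expR 4 * Num.max 1 (2 ^+ m * cmod (z - u) / 2).
Proof.
move=> us z1 u1 v1 Eu.
pose w n := cmod (z ^+ (2 ^ n) + v ^+ (2 ^ n)).
pose x n := cmod (u ^+ (2 ^ n) + v ^+ (2 ^ n)).
pose y n := cmod (u ^+ (2 ^ n) - v ^+ (2 ^ n)).
have le2 (a b : R[i]) n : cmod a <= 1 -> cmod b <= 1 ->
    0 <= cmod (a ^+ n + b ^+ n) <= 2 /\ 0 <= cmod (a ^+ n - b ^+ n) <= 2.
  move=> a1 b1; rewrite !cmod_ge0 /=; split.
    apply: le_trans (cmodD _ _) _; rewrite !cmodX (_ : 2 = 1 + 1) //.
    by rewrite lerD ?exprn_ile1 ?cmod_ge0.
  apply: le_trans (cmodB _ _) _; rewrite !cmodX (_ : 2 = 1 + 1) //.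
  by rewrite lerD ?exprn_ile1 ?cmod_ge0.
have u1' : cmod u <= 1 by rewrite u1.
have v1' : cmod v <= 1 by rewrite v1.
have w02 n : 0 <= w n <= 2 by have [] := le2 z v (2 ^ n)%N z1 v1'.
have x02 n : 0 <= x n <= 2 by have [] := le2 u v (2 ^ n)%N u1' v1'.
have y02 n : 0 <= y n <= 2 by have [] := le2 u v (2 ^ n)%N u1' v1'.
have yS n : y n.+1 = x n * y n.
  by rewrite /x /y -cmodM mulrC -subr_sqr -!exprM -!expnSr.
have w_le n : w n <= x n + 2 ^+ n * cmod (z - u).
  have -> : w n = cmod ((u ^+ (2 ^ n) + v ^+ (2 ^ n)) +
                        (z ^+ (2 ^ n) - u ^+ (2 ^ n))).
    by congr cmod; ring.
  apply: le_trans (cmodD _ _) _; rewrite lerD2l.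
  by apply: le_trans (cmod_subX_le _ _ _ z1 u1') _; rewrite natrX.
have dbl n : cmod (v ^+ n + v ^+ n) = 2.
  by rewrite -mulr2n -[_ *+ 2]mulr_natl [LHS]cmodM cmodX v1 expr1n mulr1 cmod_nat.
(* This both starts the descent of positivity and supplies the denominator 2 inside the maximum. *)
have ym : y m = 2 by rewrite /y Eu -opprD cmodN dbl.
have xgt n : (m < n)%N -> x n = 2.
  by move=> mn; rewrite /x (sqr_dyadic _ _ _ _ _ mn Eu) dbl.
rewrite (bigID (fun n => (n < m)%N)) /=.
have ge0 n : 0 <= w n / x n.
  by have /andP[w0 _] := w02 n; have /andP[x0 _] := x02 n; exact: divr_ge0.
have := prod_ratio_le (mem s) (cmod (z - u)) w x y (cmod_ge0 _) w02 x02 y02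
  yS w_le m.
rewrite ym => /(_ (ltr0Sn _ _)) low.
have high : \prod_(n <- s | (n != m) && ~~ (n < m)%N) (w n / x n) <= 1.
  apply: (@le_trans _ _ (\prod_(n <- s | (n != m) && ~~ (n < m)%N) 1));
    last by rewrite big1.
  apply: ler_prod => n /andP[nm]; rewrite -leqNgt leq_eqVlt eq_sym (negbTE nm) /=.
  move=> /xgt Ex; rewrite ge0 /= Ex ler_pdivrMr // mul1r.
  by case/andP: (w02 n).
rewrite -[leRHS]mulr1; apply: ler_pM high;
  try by apply: prodr_ge0 => n _; exact: ge0.
apply: (le_trans _ low); rewrite le_eqVlt; apply/orP; left; apply/eqP.
rewrite -big_filter -[RHS]big_filter; apply: perm_big; apply: uniq_perm.
- exact: filter_uniq.
- by rewrite filter_uniq // iota_uniq.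
move=> n; rewrite !mem_filter mem_index_iota /=.
by case: (ltnP n m) => [nm|]; rewrite ?andbF ?andbT ?(ltn_eqF nm).
Qed.

Lemma lagrange_basis_le (eta : nat -> R[i]) (N k : nat) z :
  leja_sequence (closed_unit_disk R) eta -> (1 <= k <= N)%N -> cmod z <= 1 ->
  cmod (lagrange_basis eta N k z) <= 2 * expR 4.
Proof.
move=> L /andP[k1 kN] z1.
have [v1 [s ss W]] := leja_factorization eta N L.
have [u1 _] := leja_factorization eta k.-1 L; rewrite prednK // in u1.
set v := eta N.+1 in v1 W; set u := eta k in u1.
have us : uniq s := sorted_uniq ltn_trans ltnn ss.
have kin : k \in index_iota 1 N.+1 by rewrite mem_index_iota k1 ltnS.
(* Evaluating the factorization at the node [u] gives 0, so some dyadic factor vanishes there. *)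
have [m ms Eu] : exists2 m, m \in s & u ^+ (2 ^ m) = - v ^+ (2 ^ m).
  have /(congr1 (fun p : {poly R[i]} => p.[u])) /= := W.
  rewrite (bigD1_seq k) ?iota_uniq //= hornerM hornerXsubC subrr mul0r.
  rewrite horner_prod => /esym/eqP; rewrite prodf_seq_eq0 => /hasP[m ms].
  rewrite hornerD !horner_exp hornerX hornerC /= addr_eq0 => /eqP E.
  by exists m.
pose M := (2 ^ m)%N.
(* The quotient of X^M + v^M = X^M - u^M by X - u. *)
pose S (x : R[i]) := \sum_(i < M) x ^+ (M.-1 - i) * u ^+ i.
have Lval x : \prod_(1 <= j < N.+1 | j != k) (x - eta j) =
    S x * \prod_(n <- s | n != m) (x ^+ (2 ^ n) + v ^+ (2 ^ n)).
  (* Cancelling X - u among polynomials keeps the identity valid at [x = u], where the denominator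
     is evaluated. *)
  have LE : \prod_(1 <= j < N.+1 | j != k) ('X - (eta j)%:P) =
      (\sum_(i < M) 'X ^+ (M.-1 - i) * u%:P ^+ i) *
      \prod_(n <- s | n != m) ('X ^+ (2 ^ n) + v%:P ^+ (2 ^ n)).
    have nz : 'X - u%:P != 0 by rewrite polyXsubC_eq0.
    apply: (mulfI nz); move: W; rewrite (bigD1_seq k) ?iota_uniq //= => ->.
    rewrite (bigD1_seq m) //= mulrA -subrXX; congr (_ * _).
    by rewrite -[in RHS]rmorphXn /= Eu rmorphN rmorphXn opprK.
  have /(congr1 (fun p : {poly R[i]} => p.[x])) /= := LE.
  rewrite hornerM horner_sum !horner_prod.
  under eq_bigr do rewrite hornerXsubC.
  move=> ->; congr (_ * _); apply: eq_bigr => i _.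
    by rewrite hornerM !horner_exp hornerX hornerC.
  by rewrite hornerD !horner_exp hornerX hornerC.
have Su : cmod (S u) = 2 ^+ m.
  have -> : S u = u ^+ M.-1 *+ M.
    transitivity (\sum_(i < M) u ^+ M.-1); last by rewrite sumr_const card_ord.
    apply: eq_bigr => i _; rewrite -exprD subnK //.
    by rewrite -ltnS prednK ?expn_gt0.
  by rewrite -mulr_natl [LHS]cmodM cmodX u1 expr1n mulr1 cmod_nat natrX.
rewrite /lagrange_basis prodf_div !Lval cmodM cmodV !cmodM !cmod_prod Su.
rewrite invfM mulrACA -prodf_div.
have Q := prod_ratio_dyadic_le s m z u v us z1 u1 v1 Eu.
have S1 : cmod (S z) <= 2 ^+ m.
  by apply: le_trans (cmod_sum_geom_le _ _ _ z1 _) _; rewrite ?u1 // natrX.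
have S2 : cmod (S z) * cmod (z - u) <= 2.
  rewrite mulrC -cmodM -subrXX; apply: le_trans (cmodB _ _) _.
  by rewrite !cmodX u1 expr1n (_ : 2 = 1 + 1) // lerD2r exprn_ile1 ?cmod_ge0.
have p2 : 0 < 2 ^+ m :> R by rewrite exprn_gt0.
have e4 : 0 < 2 * expR 4 :> R by rewrite mulr_gt0 // expR_gt0.
apply: le_trans (ler_wpM2l _ Q) _; first by rewrite divr_ge0 ?cmod_ge0 // ltW.
rewrite mulrCA ler_piMr ?(ltW e4) //.
(* [S2] settles the case where the maximum is the second term, [S1] the case where it is 1. *)
case: (leP 1 (2 ^+ m * cmod (z - u) / 2)) => _.
  have -> : cmod (S z) / 2 ^+ m * (2 ^+ m * cmod (z - u) / 2) =
      cmod (S z) * cmod (z - u) / 2 by field; rewrite gt_eqF.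
  by rewrite ler_pdivrMr // mul1r.
by rewrite mulr1 ler_pdivrMr // mul1r.
Qed.

End LagrangeBound.

Theorem theorem1 (R : realType) (eta : nat -> R[i]) :
  leja_sequence (closed_unit_disk R) eta ->
  (ereal_sup
     [set sup_modulus (closed_unit_disk R) (lagrange_basis eta Nk.1 Nk.2)
        | Nk in [set Nk : nat * nat | (1 <= Nk.2 <= Nk.1)%N]]
   <= (pi * expR (3 * pi))%:E)%E.
Proof.
move=> L; apply: ge_ereal_sup => _ [[N k] /= kN <-].
apply: ge_ereal_sup => _ [z /closed_unit_diskE z1 <-]; rewrite lee_fin.
apply: le_trans (lagrange_basis_le _ _ _ _ L kN z1) _.
(* It suffices that 2 <= pi and 4 <= 3 pi. *)
have p2 := pi_ge2 R.
by apply: ler_pM; rewrite ?expR_ge0 // ler_expR; lra.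
Qed.
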